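(* Let $D_n^{\ast}$, $E$, $\widetilde{C}[0,\infty)$, $\omega$ and $\Omega_n^2$ be as defined in the context. For every $f\in\widetilde{C}[0,\infty)\cap E$, every $n\in\mathbb{N}$ and every $x\in[0,\infty)$, $$\left|D_n^{\ast}(f;x)-f(x)\right|\le 2\,\omega\!\left(f;\sqrt{\Omega_n^{2}(x)}\right).$$
   Context: Fix real numbers $\mu\ge 0$ and $\lambda\ge 0$. For $k\in\mathbb{N}_0$ put $\theta_k=0$ if $k$ is even and $\theta_k=1$ if $k$ is odd. The coefficients $\gamma_\mu$ are $$\gamma_\mu(2k)=\frac{2^{2k}k!\,\Gamma(k+\mu+\frac12)}{\Gamma(\mu+\frac12)},\qquad \gamma_\mu(2k+1)=\frac{2^{2k+1}k!\,\Gamma(k+\mu+\frac32)}{\Gamma(\mu+\frac12)},\quad k\in\mathbb{N}_0,$$ and they satisfy $\gamma_\mu(k+1)=(k+1+2\mu\theta_{k+1})\gamma_\mu(k)$. The Dunkl exponential is $e_\mu(x)=\sum_{k=0}^\infty \frac{x^k}{\gamma_\mu(k)}$. Let $(a_r)_{r\ge0}$ be real numbers with $a_0\neq0$ such that $A(t)=\sum_{r=0}^\infty\frac{a_r}{\gamma_\mu(r)}t^r$ is analytic in a disc $|t|<R$ with $R>1$; assume $A(1)\ne0$ and $\frac{a_r}{A(1)}\ge0$ for all $r\ge0$. The Dunkl–Appell polynomials $p_k$ are $$p_k(x)=\sum_{m=0}^k\frac{\gamma_\mu(k)}{\gamma_\mu(m)\gamma_\mu(k-m)}a_{k-m}x^m,$$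 equivalently $A(t)e_\mu(xt)=\sum_{k=0}^\infty\frac{p_k(x)}{\gamma_\mu(k)}t^k$. For $n\in\mathbb{N}=\{1,2,\dots\}$, $x\in[0,\infty)$ and $f\in C[0,\infty)$ (for which the expression is defined), $$D_n^{\ast}(f;x)=\frac{1}{e_\mu(nx)A(1)}\sum_{k=0}^\infty\frac{p_k(nx)}{\gamma_\mu(k)}\frac{n^{k+2\mu\theta_k+\lambda+1}}{\Gamma(k+2\mu\theta_k+\lambda+1)}\int_0^\infty e^{-nt}t^{k+2\mu\theta_k+\lambda}f(t)\,dt.$$ $\Omega_n^2(x):=D_n^{\ast}((t-x)^2;x)$, i.e. $D_n^{\ast}$ applied to the function $t\mapsto(t-x)^2$ and evaluated at $x$ (the superscript $2$ in $\Omega_n^2$ is an index, not a power). $E:=\{f:[0,\infty)\to\mathbb{R} : f(x)/(1+x^2)\text{ converges to a finite limit as }x\to\infty\}$. $\widetilde{C}[0,\infty)$ is the space of uniformly continuous real-valued functions on $[0,\infty)$. For $f\in\widetilde{C}[0,\infty)$ and $\delta>0$, the modulus of continuity is $\omega(f;\delta):=\sup\{|f(x)-f(y)| : x,y\in[0,\infty),\ |x-y|\le\delta\}$. *)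

(* Defs.v *)
From HB Require Import structures.
From mathcomp Require Import all_boot all_order all_algebra.
From mathcomp Require Import all_classical all_reals all_analysis.

Set Implicit Arguments.
Unset Strict Implicit.
Unset Printing Implicit Defensive.

Import Order.TTheory GRing.Theory Num.Theory.
Import numFieldNormedType.Exports.

Local Open Scope classical_set_scope.
Local Open Scope ring_scope.

(* Functions on [0, +oo) are represented by total
   functions R -> R; every notion below only reads their values on [0, +oo). *)

Definition Gamma {R : realType} (s : R) : R :=
  \int[lebesgue_measure]_(t in `]0, +oo[) (t `^ (s - 1) * expR (- t)).

Definition theta {R : realType} (k : nat) : R := (odd k)%:R.

(* With k = m./2, this is
     gamma_mu (2 k)     = 2^(2k)   k! Gamma (k + mu + 1/2) / Gamma (mu + 1/2),
     gamma_mu (2 k + 1) = 2^(2k+1) k! Gamma (k + mu + 3/2) / Gamma (mu + 1/2). *)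
Definition gamma_mu {R : realType} (mu : R) (m : nat) : R :=
  let k := m./2 in
  let c : R := if odd m then 3 / 2 else 1 / 2 in
  2 ^+ m * (k`!)%:R * Gamma (k%:R + mu + c) / Gamma (mu + 1 / 2).

Definition dunkl_exp {R : realType} (mu x : R) : R :=
  limn (pseries (fun k => (gamma_mu mu k)^-1) x).

Definition appell_coef {R : realType} (mu : R) (a : nat -> R) (r : nat) : R :=
  a r / gamma_mu mu r.

Definition appell_A {R : realType} (mu : R) (a : nat -> R) (t : R) : R :=
  limn (pseries (appell_coef mu a) t).

Definition dunkl_appell {R : realType} (mu : R) (a : nat -> R) (k : nat)
    (x : R) : R :=
  \sum_(m < k.+1)
    gamma_mu mu k / (gamma_mu mu m * gamma_mu mu (k - m)%N) * a (k - m)%N * x ^+ m.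

(* The Lebesgue integral and the limit are total operators: their values are
   meaningful when the integrals and the series converge. *)
Definition Dstar {R : realType} (mu lam : R) (a : nat -> R) (n : nat)
    (f : R -> R) (x : R) : R :=
  (dunkl_exp mu (n%:R * x) * appell_A mu a 1)^-1 *
  limn (series (fun k : nat =>
    dunkl_appell mu a k (n%:R * x) / gamma_mu mu k *
    (n%:R `^ (k%:R + 2 * mu * theta k + lam + 1) /
     Gamma (k%:R + 2 * mu * theta k + lam + 1)) *
    \int[lebesgue_measure]_(t in `[0, +oo[)
      (expR (- (n%:R * t)) * t `^ (k%:R + 2 * mu * theta k + lam) * f t))).

Definition Omega2 {R : realType} (mu lam : R) (a : nat -> R) (n : nat)
    (x : R) : R :=
  Dstar mu lam a n (fun t => (t - x) ^+ 2) x.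

Definition in_E {R : realType} (f : R -> R) : Prop :=
  cvg (f x / (1 + x ^+ 2) @[x --> +oo]).

Definition in_Ctilde {R : realType} (f : R -> R) : Prop :=
  unif_continuous (f : subspace (`[0, +oo[ : set R) -> R).

(* A real supremum, equal to 0 when the set is unbounded; this does not occur
   for delta > 0 and f uniformly continuous on [0, +oo). *)
Definition omega {R : realType} (f : R -> R) (delta : R) : R :=
  sup [set r | exists x y : R,
    [/\ 0 <= x, 0 <= y, `|x - y| <= delta & r = `|f x - f y|]].

(* Main.v *)
Require Import Defs.
From HB Require Import structures.
From mathcomp Require Import all_boot all_order all_algebra.
From mathcomp Require Import all_classical all_reals all_analysis.
From mathcomp Require Import measurable_realfun ring lra.
Set Implicit Arguments.
Unset Strict Implicit.
Unset Printing Implicit Defensive.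
Import Order.TTheory GRing.Theory Num.Theory.
Import numFieldNormedType.Exports.
Local Open Scope classical_set_scope.
Local Open Scope ring_scope.

(** The operator is a positive average that fixes constants, and this is the
whole reason for the estimate.  For each k the integral in [Dstar], with its
Gamma factor, is the mean of f under a gamma distribution of rate n
([gamma_mean]); the outer factors [dunkl_weight] are nonnegative and sum to 1,
because A(t) e_mu(xt) is the generating function of the p_k(x) / gamma_mu(k)
and is evaluated here at t = 1, with n x in place of x.

Let d > 0.  Cutting the segment from t to x into pieces of length at most d
shows that |f t - f x| <= omega(f; d) (1 + floor (|t - x| / d)), and
floor u <= u^2 for u >= 0, whence

  |f t - f x| <= omega(f; d) (1 + (t - x)^2 / d^2)      ([omega_quadratic]).

Averaging this gives |D f x - f x| <= omega(f; d) (1 + Omega / d^2), where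
Omega is the second central moment of the operator; the choice
d = sqrt Omega turns the bracket into 2.  The quadratic majorant takes the
place of the usual appeal to the Cauchy-Schwarz inequality.

Three analytic facts support this computation.

- The moments of the gamma distributions.  The functional equation of the
  Gamma integral ([gamma_int_rec]) is the fundamental theorem of calculus on
  [1/m, m], followed by monotone convergence; finiteness and positivity follow
  from it.  A change of variables ([gamma_int_scale]) normalises the densities.
  The result is [gamma_mean_sq].

- The convergence of the series of second moments.  The radius of convergence
  of A exceeds 1, so the weights are summable against r^k for some r > 1
  ([cvg_dunkl_weight_pseries], a Cauchy product of nonnegative series), while
  the second moments grow only quadratically in k
  ([gamma_shape_quadratic_le]).

- The positivity of Omega.  Each gamma distribution involved has variance at
  least 1 / n^2, so Omega >= 1 / n^2 and d = sqrt Omega is an admissible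
  choice. *)

(** * Gamma integrals with a rate parameter *)

Definition gamma_kernel {R : realType} (c s t : R) : R :=
  t `^ (s - 1) * expR (- (c * t)).

(** Extended-real valued, so that the functional equation can be established
before finiteness, which is deduced from it. *)
Definition gamma_int {R : realType} (c s : R) : \bar R :=
  (\int[lebesgue_measure]_(t in `]0%R, +oo[) (gamma_kernel c s t)%:E)%E.

Lemma measurable_gamma_kernel {R : realType} (c s : R) (D : set R) :
  measurable D -> measurable_fun D (gamma_kernel c s).
Proof.
move=> mD; apply: measurable_funTS; apply: measurable_funM.
  exact: measurable_powR.
apply: measurableT_comp => //; exact: measurableT_comp.
Qed.

Lemma gamma_kernel_ge0 {R : realType} (c s t : R) : 0 <= gamma_kernel c s t.
Proof. by rewrite mulr_ge0 ?powR_ge0 ?expR_ge0. Qed.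

Lemma gamma_kernelS {R : realType} (c s t : R) : 0 < t ->
  gamma_kernel c (s + 1) t = t * gamma_kernel c s t.
Proof.
move=> t0; rewrite /gamma_kernel mulrA; congr (_ * _).
by rewrite addrAC (@powRD _ t (s - 1) 1) ?(gt_eqF t0) ?implybT// powRr1 ?ltW// mulrC.
Qed.

Lemma gamma_int_ge0 {R : realType} (c s : R) : (0 <= gamma_int c s)%E.
Proof. by apply: integral_ge0 => t _; rewrite lee_fin gamma_kernel_ge0. Qed.

Lemma is_derive_expRNM {R : realType} (c t : R) :
  is_derive t 1 (fun u => expR (- (c * u))) (expR (- (c * t)) * - c).
Proof.
have h : is_derive t 1 (fun u : R => - (c * u)) (- c).
  rewrite (_ : (fun u => _) = (- c) *: id); last first.
    by apply/funext => u; rewrite -mulNr.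
  by apply: is_derive_eq; rewrite /GRing.scale /= mulr1.
exact: (@is_derive1_comp _ expR (fun u => - (c * u))).
Qed.

(** The derivative of t^s e^(-ct) is a combination of two Gamma integrands: this
is what integration by parts amounts to here. *)
Lemma is_derive_gamma_kernelS {R : realType} (c s t : R) : 0 < t ->
  is_derive t 1 (gamma_kernel c (s + 1))
    (s * gamma_kernel c s t - c * gamma_kernel c (s + 1) t).
Proof.
move=> t0; rewrite gamma_kernelS//.
rewrite (_ : gamma_kernel c (s + 1) =
  (fun u => u `^ s) * (fun u => expR (- (c * u)))); last first.
  by apply/funext => u; rewrite /gamma_kernel addrK.
have /= h1 := is_derive1_powR s t0.
have h3 := is_derive_expRNM c t.
apply: is_derive_eq.
rewrite /gamma_kernel /= -[_ *: _]/(_ * _) -[X in _ + X]/(_ * _).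
have -> : t `^ s = t `^ (s - 1) * t.
  by rewrite -{1}(subrK 1 s) (@powRD _ t (s - 1) 1) ?(gt_eqF t0) ?implybT// powRr1 ?ltW.
by ring.
Qed.

(** For an integer k >= s, the term of degree k + 1 of the exponential series
of c t dominates t^(k+1), one power more than needed. *)
Lemma powR_expR_le {R : realType} (c s : R) : 0 < c ->
  exists K : R, forall t, 1 <= t -> t `^ s * expR (- (c * t)) <= K / t.
Proof.
move=> c0; have [k ks] : exists k : nat, s <= k%:R.
  exists (Num.truncn `|s|).+1; rewrite (le_trans (ler_norm _))// ltW//.
  by rewrite truncnS_gt.
exists ((k.+1`!)%:R / c ^+ k.+1) => t t1.
have t0 : 0 < t by exact: lt_le_trans t1.
have ct : 0 <= c * t by rewrite mulr_ge0 ?ltW.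
have fk : 0 < (k.+1`!)%:R :> R by rewrite ltr0n fact_gt0.
rewrite expRN ler_pdivrMr ?expR_gt0//.
have h : (c * t) ^+ k.+1 / (k.+1)`!%:R <= expR (c * t).
  by apply: le_trans (expR_ge1Dxn k ct); rewrite lerDr.
apply: (@le_trans _ _ (t ^+ k)).
  by rewrite -powR_mulrn ?(ltW t0)//; exact: ler_powR.
apply: (le_trans _ (ler_wpM2l _ h)); last first.
  by rewrite !divr_ge0 ?exprn_ge0 ?ltW.
rewrite exprMn (exprS t) le_eqVlt; apply/orP; left; apply/eqP.
move: fk (exprn_gt0 k.+1 c0); move: (_%:R) (c ^+ _) (t ^+ _) => F C T F0 C0.
by field; rewrite !gt_eqF.
Qed.

Lemma within_continuous_gamma_kernel {R : realType} (c s a b : R) : 0 < a ->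
  {within `[a, b], continuous (gamma_kernel c s)}.
Proof.
move=> a0; apply: derivable_within_continuous => t.
rewrite in_itv/= => /andP[at_ _]; have t0 : 0 < t by exact: lt_le_trans at_.
by have [] := is_derive_gamma_kernelS c (s - 1) t0; rewrite subrK.
Qed.

(** The boundary terms are those of the antiderivative t^s e^(-ct).  Staying
away from 0 keeps the integrands continuous even when s < 1. *)
Lemma gamma_int_segment {R : realType} (c s a b : R) : 0 < c -> 0 < s ->
  0 < a -> a < b ->
  (c%:E * (\int[lebesgue_measure]_(t in `[a, b]) (gamma_kernel c (s + 1) t)%:E) =
  s%:E * (\int[lebesgue_measure]_(t in `[a, b]) (gamma_kernel c s t)%:E) +
  (gamma_kernel c (s + 1) a - gamma_kernel c (s + 1) b)%:E)%E.
Proof.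
move=> c0 s0 a0 ab.
have ci s' : {within `[a, b], continuous (gamma_kernel c s')}.
  exact: within_continuous_gamma_kernel.
have ii s' : lebesgue_measure.-integrable `[a, b] (EFin \o gamma_kernel c s').
  by apply: continuous_compact_integrable => //; exact: segment_compact.
have pos t : t \in `]a, b[ -> 0 < t.
  by rewrite in_itv/= => /andP[+ _]; exact: lt_trans.
pose g t := s * gamma_kernel c s t - c * gamma_kernel c (s + 1) t.
have H : (\int[lebesgue_measure]_(t in `[a, b]) (g t)%:E =
    (gamma_kernel c (s + 1) b)%:E - (gamma_kernel c (s + 1) a)%:E)%E.
  apply: continuous_FTC2 => //.
  - apply/subspace_continuousP => t tab; apply: cvgB.
      by apply: cvgMr; move/subspace_continuousP : (ci s); exact.
    by apply: cvgMr; move/subspace_continuousP : (ci (s + 1)); exact.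
  - split.
    + by move=> t tab; have [] := is_derive_gamma_kernelS c s (pos _ tab).
    + by have /continuous_within_itvP [] := ci (s + 1).
    + by have /continuous_within_itvP [] := ci (s + 1).
  - move=> t tab; rewrite derive1E.
    by have [_ ->] := is_derive_gamma_kernelS c s (pos _ tab).
have I0 s' : (\int[lebesgue_measure]_(t in `[a, b]) (gamma_kernel c s' t)%:E
     \is a fin_num)%E by exact: integrable_fin_num (ii s').
(* Convertible form, which keeps the kernels folded. *)
rewrite -[LHS]/(\int[lebesgue_measure]_(t in `[a, b])
  (s%:E * (gamma_kernel c s t)%:E - c%:E * (gamma_kernel c (s + 1) t)%:E))%E in H.
move: H; rewrite integralB//; [|by apply: integrableZl => //; exact: ii..].
rewrite !integralZl//; [|exact: ii..].
rewrite -(fineK (I0 s)) -(fineK (I0 (s + 1))) -!EFinM -!EFinD => -[].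
by move=> H; congr EFin; lra.
Qed.

Lemma gamma_int_exhaustion {R : realType} (c s : R) :
  (\int[lebesgue_measure]_(t in `[(m.+2%:R^-1)%R, m.+2%:R%R]) (gamma_kernel c s t)%:E
     @[m --> \oo] --> gamma_int c s)%E.
Proof.
have -> : gamma_int c s = (\int[lebesgue_measure]_(t in
    \bigcup_m (`[(m.+2%:R^-1)%R, m.+2%:R%R]%classic : set R)) (gamma_kernel c s t)%:E)%E.
  congr (integral _ _ _); apply/seteqP; split => [t|t [m _]]; last first.
    by rewrite /= !in_itv/= andbT => /andP[+ _]; apply: lt_le_trans.
  rewrite /= in_itv/= andbT => t0.
  exists (Num.truncn (Num.max t t^-1)) => //; rewrite /= in_itv/=.
  have mt : Num.max t t^-1 <= (Num.truncn (Num.max t t^-1)).+2%:R.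
    by rewrite (le_trans (ltW (truncnS_gt _)))// ler_nat.
  rewrite (le_trans _ mt) ?le_max ?lexx// andbT.
  by rewrite invf_ple ?posrE// (le_trans _ mt)// le_max lexx orbT.
apply: ge0_nondecreasing_set_cvg_integral => //.
- apply/nondecreasing_seqP => m; rewrite subsetEset => t /=.
  rewrite !in_itv/= => /andP[h1 h2]; apply/andP; split.
    by apply: le_trans h1; rewrite lef_pV2 ?posrE// ler_nat.
  by apply: (le_trans h2); rewrite ler_nat.
- by move=> m; apply/measurable_EFinP; exact: measurable_gamma_kernel.
- by move=> m t _; rewrite lee_fin gamma_kernel_ge0.
Qed.

Lemma gamma_kernel_boundary_cvg0 {R : realType} (c s : R) : 0 < c -> 0 < s ->
  gamma_kernel c (s + 1) m.+2%:R^-1 - gamma_kernel c (s + 1) m.+2%:R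
    @[m --> \oo] --> (0 : R).
Proof.
move=> c0 s0; have [K HK] := powR_expR_le s c0.
have harm : m.+2%:R^-1 @[m --> \oo] --> (0 : R).
  by have := @cvg_harmonic R; rewrite -cvg_shiftS.
rewrite -[X in _ --> X](subr0 0); apply: cvgB.
  apply: (@squeeze_cvgr _ _ _ _ (cst 0) (fun m => m.+2%:R^-1 `^ s)).
  - near=> m; rewrite /cst /gamma_kernel addrK mulr_ge0 ?powR_ge0 ?expR_ge0//=.
    rewrite -[leRHS]mulr1 ler_wpM2l ?powR_ge0// expR_le1 oppr_le0.
    by rewrite mulr_ge0 ?ltW.
  - exact: cvg_cst.
  - have H0 : m.+2%:R^-1 @[m --> \oo] --> (0 : R)^'+.
      move=> A /harm hA.
      have {}hA : \forall m \near \oo, 0 < (m.+2%:R^-1 : R) -> A m.+2%:R^-1 := hA.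
      have : \forall m \near \oo, A (m.+2%:R^-1 : R).
        by move: hA; apply: filterS => m; apply; rewrite invr_gt0.
      exact.
    exact: (cvg_comp _ (@powR R ^~ s) H0 (powR_cvg0 s0)).
apply: (@squeeze_cvgr _ _ _ _ (cst 0) (fun m => K * m.+2%:R^-1)).
- near=> m; rewrite /cst /gamma_kernel addrK mulr_ge0 ?powR_ge0 ?expR_ge0//=.
  by apply: HK; rewrite ler1n.
- exact: cvg_cst.
- by rewrite -[X in _ --> X](mulr0 K); exact: cvgMr.
Unshelve. all: by end_near. Qed.

(** Functional equation of the Gamma integral, with rate c: the limit of the
identity on the segments [1/m, m], where the boundary terms vanish. *)
Lemma gamma_int_rec {R : realType} (c s : R) : 0 < c -> 0 < s ->
  (c%:E * gamma_int c (s + 1) = s%:E * gamma_int c s)%E.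
Proof.
move=> c0 s0.
have lim1 := cvgeZl (y := c%:E) isT (@gamma_int_exhaustion R c (s + 1)).
apply: (cvg_unique _ lim1) => //.
rewrite /= -[(s%:E * _)%E]adde0.
under eq_cvg => m.
  rewrite gamma_int_segment//; last first.
    by rewrite (@lt_trans _ _ 1)// ?ltr1n// invf_lt1// ltr1n.
  over.
apply: cvgeD; first by rewrite fin_num_adde_defl.
  by apply: cvgeZl => //; exact: gamma_int_exhaustion.
by apply: cvg_EFin; [exact: nearW|exact: gamma_kernel_boundary_cvg0].
Qed.

Lemma gamma_int_obnd_cbnd {R : realType} (c s : R) :
  (\int[lebesgue_measure]_(t in `[0%R, +oo[) (gamma_kernel c s t)%:E)%E =
  gamma_int c s.
Proof.
rewrite /gamma_int integral_itv_obnd_cbnd//.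
by apply/measurable_EFinP; exact: measurable_gamma_kernel.
Qed.

Lemma gamma_int1 {R : realType} (c : R) : 0 < c -> gamma_int c 1 = (c^-1)%:E.
Proof.
move=> c0.
have kE : gamma_kernel c 1 = fun t => expR (- (c * t)).
  by apply/funext => t; rewrite /gamma_kernel subrr powRr0 mul1r.
have dE (t : R) : is_derive t 1 (gamma_kernel c 1) (- c * gamma_kernel c 1 t).
  by rewrite kE mulrC; exact: is_derive_expRNM.
have ck : continuous (gamma_kernel c 1).
  by move=> t; apply/differentiable_continuous/derivable1_diffP; have [] := dE t.
rewrite -gamma_int_obnd_cbnd.
rewrite (@ge0_continuous_FTC2y _ _ (fun t => - c^-1 * gamma_kernel c 1 t) _ 0).
- by rewrite kE mulr0 oppr0 expR0 mulr1 sub0e EFinN oppeK.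
- by move=> t _; exact: gamma_kernel_ge0.
- exact: continuous_subspaceT.
- rewrite -[X in _ --> X](mulr0 (- c^-1)); apply: cvgMr; rewrite kE.
  apply: (cvg_comp (fun t => c * t) (fun t : R => expR (- t)) _ (@cvgr_expR R)).
  exact: gt0_cvgMry.
- move=> t _; apply: derivableM; first exact: derivable_cst.
  by have [] := dE t.
- by apply: cvgMr; apply: cvg_at_right_filter; exact: ck.
- move=> t _; rewrite derive1E.
  have h : is_derive t 1 ((- c^-1) *: gamma_kernel c 1) ((- c^-1) *: (- c * gamma_kernel c 1 t)).
    by have h := dE t; exact: is_deriveZ.
  by have [_ ->] := h; rewrite /GRing.scale /= mulrA mulrNN mulVf ?mul1r// gt_eqF.
Qed.

(** By the functional equation, finiteness at s is equivalent to finiteness at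
s + 1, and holds at every positive integer.  The pointwise bound
t^s <= 1 + t^k, for an integer k >= s, then settles s + 1. *)
Lemma gamma_int_fin_num {R : realType} (c s : R) : 0 < c -> 0 < s ->
  gamma_int c s \is a fin_num.
Proof.
move=> c0 s0; have fin_step r : 0 < r ->
    (gamma_int c (r + 1) \is a fin_num) = (gamma_int c r \is a fin_num).
  move=> r0; have := gamma_int_rec c0 r0.
  move: (gamma_int_ge0 c (r + 1)) (gamma_int_ge0 c r).
  case: (gamma_int c (r + 1)) => [u| |]//; case: (gamma_int c r) => [v| |]//= _ _.
  - by rewrite gt0_muley// ?lte_fin.
  - by rewrite gt0_muley// ?lte_fin.
have fin_nat k : gamma_int c k.+1%:R \is a fin_num.
  elim: k => [|k IHk]; first by rewrite gamma_int1.
  by rewrite -natr1 fin_step.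
have [k sk] : exists k : nat, s <= k%:R.
  by exists (Num.truncn s).+1; rewrite ltW// truncnS_gt.
rewrite -fin_step// ge0_fin_numE ?gamma_int_ge0//.
apply: (@le_lt_trans _ _ (gamma_int c 1 + gamma_int c k.+1%:R)); last first.
  by rewrite gamma_int1// lte_add_pinfty ?ltry// ltey_eq fin_nat.
rewrite /gamma_int -ge0_integralD//; last 4 first.
  by move=> t _; rewrite lee_fin gamma_kernel_ge0.
  by apply/measurable_EFinP; exact: measurable_gamma_kernel.
  by move=> t _; rewrite lee_fin gamma_kernel_ge0.
  by apply/measurable_EFinP; exact: measurable_gamma_kernel.
apply: ge0_le_integral => //.
- by move=> t _; rewrite lee_fin gamma_kernel_ge0.
- by apply/measurable_EFinP; exact: measurable_gamma_kernel.
- rewrite -[X in measurable_fun _ X]/(EFin \o (gamma_kernel c 1 \+ gamma_kernel c k.+1%:R)).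
  by apply/measurable_EFinP; apply: measurable_funD; exact: measurable_gamma_kernel.
move=> t /=; rewrite in_itv/= andbT => t0.
rewrite -EFinD lee_fin /gamma_kernel -mulrDl ler_wpM2r ?expR_ge0//.
rewrite addrK subrr powRr0 -natr1 addrK.
have [t1|t1] := leP 1 t; first by rewrite (le_trans (ler_powR t1 sk))// lerDr.
rewrite (@le_trans _ _ 1) ?lerDl ?powR_ge0//.
by rewrite -(powRr0 t) ger_powR ?t0 ?ltW.
Qed.

(** At s + 1 the integrand is at least e^(-2c) on [1, 2]; the functional
equation brings positivity down to s. *)
Lemma gamma_int_gt0 {R : realType} (c s : R) : 0 < c -> 0 < s ->
  (0 < gamma_int c s)%E.
Proof.
move=> c0 s0; suff : (0 < gamma_int c (s + 1))%E.
  move=> i1; have : (0 < s%:E * gamma_int c s)%E.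
    by rewrite -gamma_int_rec// mule_gt0// lte_fin.
  by rewrite pmule_rgt0// lte_fin.
apply: (@lt_le_trans _ _ (expR (- (c * 2)))%:E); first by rewrite lte_fin expR_gt0.
rewrite /gamma_int.
apply: (@le_trans _ _ (\int[lebesgue_measure]_(t in `[1%R, 2%R])
   (gamma_kernel c (s + 1) t)%:E)%E); last first.
  apply: ge0_subset_integral => //.
  - by apply/measurable_EFinP; exact: measurable_gamma_kernel.
  - by move=> t _; rewrite lee_fin gamma_kernel_ge0.
  - by move=> t /=; rewrite !in_itv/= andbT => /andP[+ _]; exact: lt_le_trans.
apply: (@le_trans _ _ (\int[lebesgue_measure]_(t in `[1%R, 2%R])
   (expR (- (c * 2)))%:E)%E).
  rewrite integral_cst//= lebesgue_measure_itv/= lte_fin ltr1n.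
  by rewrite -EFinB (_ : 2 - 1 = 1 :> R) ?mule1//; ring.
apply: ge0_le_integral => //.
- by apply/measurable_EFinP; exact: measurable_gamma_kernel.
move=> t /=; rewrite in_itv/= => /andP[t1 t2].
rewrite lee_fin /gamma_kernel addrK -[leLHS]mul1r ler_pM ?expR_ge0//.
  by rewrite -(powRr0 t) ler_powR// ltW.
by rewrite ler_expR lerN2 ler_wpM2l// ltW.
Qed.

(** Substitution u = c t.  It is carried out at s + 1, where the integrand is
continuous up to 0, and the functional equation transfers it to s. *)
Lemma gamma_int_scale {R : realType} (c s : R) : 0 < c -> 0 < s ->
  ((c `^ s)%:E * gamma_int c s = gamma_int 1 s)%E.
Proof.
move=> c0 s0.
have powRS : c `^ (s + 1) = c * c `^ s.
  by rewrite -(mulr_powRB1 (ltW c0) (addr_gt0 s0 ltr01)) addrK.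
suff : ((c `^ (s + 1))%:E * gamma_int c (s + 1) = gamma_int 1 (s + 1))%E.
  have := gamma_int_rec c0 s0; have := gamma_int_rec (ltr01 : 0 < 1 :> R) s0.
  have s10 : 0 < s + 1 by rewrite addr_gt0.
  have fin (c' s' : R) : 0 < c' -> 0 < s' -> exists u, gamma_int c' s' = u%:E.
    by move=> c'0 s'0; exists (fine (gamma_int c' s')); rewrite fineK ?gamma_int_fin_num.
  have [uc ->] := fin _ _ c0 s0; have [u1 ->] := fin _ _ ltr01 s0.
  have [vc ->] := fin _ _ c0 s10; have [v1 ->] := fin _ _ ltr01 s10.
  rewrite powRS -!EFinM mul1r => -[h1] [h2] [h3]; congr EFin.
  by apply: (mulfI (lt0r_neq0 s0)); rewrite -h1 -h3 mulrCA -h2 mulrA (mulrC c).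
have ck : {within `[0, +oo[, continuous (gamma_kernel 1 (s + 1))}.
  apply/continuous_within_itvcyP; split.
    move=> t; rewrite in_itv/= andbT => t0.
    apply/differentiable_continuous/derivable1_diffP.
    by have [] := is_derive_gamma_kernelS 1 s t0.
  have kE : gamma_kernel 1 (s + 1) = fun t => t `^ s * expR (- (1 * t)).
    by apply/funext => t; rewrite /gamma_kernel addrK.
  rewrite kE [X in _ --> X](_ : _ = 0 * expR (- (1 * 0))); last first.
    by rewrite powR0 ?gt_eqF.
  apply: cvgM; first exact: powR_cvg0.
  apply: cvg_at_right_filter; apply: (@cvg_comp _ _ _ (fun t => - (1 * t)) expR).
    by apply: cvgN; apply: cvgMr; exact: cvg_id.
  exact: continuous_expR.
have dF : (fun t : R => c * t)^`()%classic = cst c.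
  apply/funext => t; rewrite derive1E.
  have h : is_derive t 1 (c *: (@id R)) (c *: 1) by exact: is_deriveZ.
  by have [_ ->] := h; rewrite /GRing.scale /= mulr1.
rewrite -[RHS]gamma_int_obnd_cbnd -[in RHS](mulr0 c).
rewrite (@increasing_ge0_integration_by_substitutiony _ (fun t => c * t)) ?dF.
- rewrite -gamma_int_obnd_cbnd -ge0_integralZl//; last 3 first.
  + by apply/measurable_EFinP; exact: measurable_gamma_kernel.
  + by move=> t _; rewrite lee_fin gamma_kernel_ge0.
  + by rewrite lee_fin powR_ge0.
  apply: eq_integral => t; rewrite inE/= in_itv/= andbT => t0.
  rewrite -EFinM -[X in _ = X%:E]/(gamma_kernel 1 (s + 1) (c * t) * c).
  rewrite /gamma_kernel addrK mul1r powRM ?(ltW c0)//.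
  by rewrite powRS; congr EFin; ring.
- by move=> u v _ _ uv; rewrite ltr_pM2l.
- by move=> t _; exact: cst_continuous.
- exact: is_cvg_cst.
- exact: is_cvg_cst.
- split.
    by move=> t _; apply: derivableM; [exact: derivable_cst|exact: derivable_id].
  by apply: cvg_at_right_filter; apply: cvgMr; exact: cvg_id.
- exact: gt0_cvgMry.
- by rewrite mulr0.
- by move=> t _; exact: gamma_kernel_ge0.
Qed.

(** * The mean of a function under a gamma distribution *)

Lemma gamma_int_Gamma {R : realType} (s : R) : 0 < s ->
  gamma_int 1 s = (Gamma s)%:E.
Proof.
move=> s0; have -> : Gamma s = fine (gamma_int 1 s).
  by congr fine; apply: eq_integral => t _; rewrite /gamma_kernel mul1r.
by rewrite fineK// gamma_int_fin_num.
Qed.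

Lemma Gamma_gt0 {R : realType} (s : R) : 0 < s -> 0 < Gamma s.
Proof.
by move=> s0; have := gamma_int_gt0 ltr01 s0; rewrite gamma_int_Gamma// lte_fin.
Qed.

Lemma GammaS {R : realType} (s : R) : 0 < s -> Gamma (s + 1) = s * Gamma s.
Proof.
move=> s0; have := gamma_int_rec (ltr01 : 0 < 1 :> R) s0.
have s1 : 0 < s + 1 by rewrite addr_gt0.
by rewrite (gamma_int_Gamma s0) (gamma_int_Gamma s1) -!EFinM mul1r => -[].
Qed.

Lemma integrable_gamma_kernel {R : realType} (c s : R) : 0 < c -> 0 < s ->
  lebesgue_measure.-integrable `[0, +oo[ (EFin \o gamma_kernel c s).
Proof.
move=> c0 s0; apply/integrableP; split.
  by apply/measurable_EFinP; exact: measurable_gamma_kernel.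
under eq_integral do rewrite /= ger0_norm ?gamma_kernel_ge0//.
by rewrite gamma_int_obnd_cbnd -ge0_fin_numE ?gamma_int_ge0 ?gamma_int_fin_num.
Qed.

Lemma Rintegral_gamma_kernel {R : realType} (c s : R) : 0 < c -> 0 < s ->
  \int[lebesgue_measure]_(t in `[0, +oo[) gamma_kernel c s t = Gamma s / c `^ s.
Proof.
move=> c0 s0; rewrite /Rintegral gamma_int_obnd_cbnd.
have := gamma_int_scale c0 s0; rewrite gamma_int_Gamma//.
rewrite -(fineK (gamma_int_fin_num c0 s0)) -EFinM => -[<-].
by rewrite mulrAC divff ?mul1r// gt_eqF// powR_gt0.
Qed.

(** Expectation of f under the gamma distribution of shape s and rate c. *)
Definition gamma_mean {R : realType} (c s : R) (f : R -> R) : R :=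
  c `^ s / Gamma s *
  \int[lebesgue_measure]_(t in `[0, +oo[) (gamma_kernel c s t * f t).

Lemma gamma_kernelS_ge0 {R : realType} (c s t : R) : 0 < s -> 0 <= t ->
  gamma_kernel c (s + 1) t = t * gamma_kernel c s t.
Proof.
move=> s0; rewrite le_eqVlt => /predU1P[<-|]; last exact: gamma_kernelS.
by rewrite /gamma_kernel addrK powR0 ?gt_eqF// !mul0r.
Qed.

Lemma gamma_kernel_sqE {R : realType} (c s x t : R) : 0 < s -> 0 <= t ->
  gamma_kernel c s t * (t - x) ^+ 2 =
  gamma_kernel c (s + 1 + 1) t - 2 * x * gamma_kernel c (s + 1) t
    + x ^+ 2 * gamma_kernel c s t.
Proof.
move=> s0 t0; rewrite !gamma_kernelS_ge0 ?addr_gt0//; ring.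
Qed.

Lemma integrable_gamma_kernelZ {R : realType} (c s r : R) : 0 < c -> 0 < s ->
  lebesgue_measure.-integrable `[0, +oo[
    (EFin \o (fun t => r * gamma_kernel c s t)).
Proof.
by move=> c0 s0; exact: (integrableZl _ _ (integrable_gamma_kernel c0 s0)).
Qed.

Lemma integrable_gamma_kernel_sq {R : realType} (c s x : R) : 0 < c -> 0 < s ->
  lebesgue_measure.-integrable `[0, +oo[
    (EFin \o (fun t => gamma_kernel c s t * (t - x) ^+ 2)).
Proof.
move=> c0 s0; have s1 : 0 < s + 1 by rewrite addr_gt0.
have s2 : 0 < s + 1 + 1 by rewrite addr_gt0.
have i12 : lebesgue_measure.-integrable `[0, +oo[ (EFin \o (fun t =>
    gamma_kernel c (s + 1 + 1) t - 2 * x * gamma_kernel c (s + 1) t)).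
  exact: (integrableB _ (integrable_gamma_kernel c0 s2)
    (integrable_gamma_kernelZ (2 * x) c0 s1)).
have i3 : lebesgue_measure.-integrable `[0, +oo[ (EFin \o (fun t =>
    gamma_kernel c (s + 1 + 1) t - 2 * x * gamma_kernel c (s + 1) t
    + x ^+ 2 * gamma_kernel c s t)).
  exact: (integrableD _ i12 (integrable_gamma_kernelZ (x ^+ 2) c0 s0)).
apply: eq_integrable i3 => //.
by move=> t; rewrite inE/= in_itv/= andbT => t0; rewrite gamma_kernel_sqE.
Qed.

(** The squared bias plus the variance: the distribution has mean s / c and
variance s / c^2. *)
Lemma gamma_mean_sq {R : realType} (c s x : R) : 0 < c -> 0 < s ->
  gamma_mean c s (fun t => (t - x) ^+ 2) = (s / c - x) ^+ 2 + s / c ^+ 2.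
Proof.
move=> c0 s0; have s1 : 0 < s + 1 by rewrite addr_gt0.
have s2 : 0 < s + 1 + 1 by rewrite addr_gt0.
have -> : gamma_mean c s (fun t => (t - x) ^+ 2) = c `^ s / Gamma s *
    \int[lebesgue_measure]_(t in `[0, +oo[)
      (gamma_kernel c (s + 1 + 1) t - 2 * x * gamma_kernel c (s + 1) t
       + x ^+ 2 * gamma_kernel c s t).
  congr (_ * _); apply: eq_Rintegral => t.
  by rewrite inE/= in_itv/= andbT => t0; rewrite gamma_kernel_sqE.
have i1 := integrable_gamma_kernelZ (2 * x) c0 s1.
have i12 : lebesgue_measure.-integrable `[0, +oo[ (EFin \o (fun t =>
    gamma_kernel c (s + 1 + 1) t - 2 * x * gamma_kernel c (s + 1) t)).
  exact: (integrableB _ (integrable_gamma_kernel c0 s2) i1).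
rewrite RintegralD//; last exact: integrable_gamma_kernelZ.
rewrite RintegralB//; last exact: integrable_gamma_kernel.
rewrite !RintegralZl//; [|exact: integrable_gamma_kernel..].
rewrite !Rintegral_gamma_kernel// !GammaS//.
have P0 : c `^ s != 0 by rewrite gt_eqF// powR_gt0.
have G0 : Gamma s != 0 by rewrite gt_eqF// Gamma_gt0.
have c1 : c != 0 by rewrite gt_eqF.
rewrite !powRD ?powRr1 ?(ltW c0)// ?c1 ?implybT//.
by field; rewrite c1 P0 G0.
Qed.

(** The mean fixes constants and is monotone, so a quadratic majorant of
|f - y| may be integrated; the majorant also makes f integrable. *)
Lemma gamma_mean_approx {R : realType} (c s x y w K : R) (f : R -> R) :
  0 < c -> 0 < s ->
  measurable_fun (`[0, +oo[%classic : set R) f ->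
  (forall t : R, 0 <= t -> `|f t - y| <= w * (1 + K * (t - x) ^+ 2)) ->
  `|gamma_mean c s f - y| <= w * (1 + K * gamma_mean c s (fun t => (t - x) ^+ 2)).
Proof.
move=> c0 s0 mf fy.
have P0 : c `^ s != 0 by rewrite gt_eqF// powR_gt0.
have G0 : Gamma s != 0 by rewrite gt_eqF// Gamma_gt0.
have i1 := integrable_gamma_kernel c0 s0.
have i2 := integrable_gamma_kernel_sq x c0 s0.
pose g t := w * gamma_kernel c s t + w * K * (gamma_kernel c s t * (t - x) ^+ 2).
have ig : lebesgue_measure.-integrable `[0, +oo[ (EFin \o g).
  exact: (integrableD _ (integrableZl _ w i1) (integrableZl _ (w * K) i2)).
have ih : lebesgue_measure.-integrable `[0, +oo[
    (EFin \o (fun t => gamma_kernel c s t * (f t - y))).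
  apply: le_integrable ig => //.
    apply/measurable_EFinP; apply: measurable_funM.
      exact: measurable_gamma_kernel.
    by apply: measurable_funB => //; exact: measurable_cst.
  move=> t; rewrite /= in_itv/= andbT => t0.
  rewrite lee_fin (le_trans _ (ler_norm _))// normrM ger0_norm ?gamma_kernel_ge0//.
  rewrite (le_trans (ler_wpM2l (gamma_kernel_ge0 _ _ _) (fy t t0)))//.
  by rewrite /g le_eqVlt; apply/orP; left; apply/eqP; ring.
have -> : gamma_mean c s f - y = c `^ s / Gamma s *
    \int[lebesgue_measure]_(t in `[0, +oo[) (gamma_kernel c s t * (f t - y)).
  have -> : gamma_mean c s f = c `^ s / Gamma s *
      \int[lebesgue_measure]_(t in `[0, +oo[)
        (gamma_kernel c s t * (f t - y) + y * gamma_kernel c s t).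
    by congr (_ * _); apply: eq_Rintegral => t _; ring.
  rewrite RintegralD//; last exact: integrable_gamma_kernelZ.
  by rewrite RintegralZl// Rintegral_gamma_kernel//; field; rewrite P0 G0.
have -> : w * (1 + K * gamma_mean c s (fun t => (t - x) ^+ 2)) =
    c `^ s / Gamma s * \int[lebesgue_measure]_(t in `[0, +oo[) g t.
  rewrite /g RintegralD//; [|exact: (integrableZl _ w i1)|exact: (integrableZl _ (w * K) i2)].
  rewrite !RintegralZl// Rintegral_gamma_kernel// /gamma_mean.
  by field; rewrite P0 G0.
have q0 : 0 <= c `^ s / Gamma s by rewrite divr_ge0 ?powR_ge0 ?ltW ?Gamma_gt0.
rewrite normrM (ger0_norm q0); apply: ler_wpM2l => //.
apply: (le_trans (le_normr_Rintegral _ ih)) => //.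
apply: le_Rintegral => //; first exact: integrable_norm.
move=> t; rewrite /= in_itv/= andbT => t0.
rewrite normrM ger0_norm ?gamma_kernel_ge0//.
rewrite (le_trans (ler_wpM2l (gamma_kernel_ge0 _ _ _) (fy t t0)))//.
by rewrite /g le_eqVlt; apply/orP; left; apply/eqP; ring.
Qed.

(** * Series with nonnegative terms *)

(** Sum over the triangle of indices i + m < N, row by row. *)
Lemma cauchy_product_series {R : comPzRingType} (u v : R^nat) (N : nat) :
  series (fun k => \sum_(m < k.+1) u (k - m)%N * v m) N =
  \sum_(m < N) v m * series u (N - m)%N.
Proof.
elim: N => [|N IHN]; first by rewrite /series /= big_ord0 big_geq.
rewrite seriesSr IHN [in RHS]big_ord_recr/= subSn// subnn seriesSr.
rewrite [series u 0]/series/= big_geq// add0r [X in _ + X = _]big_ord_recr/=.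
rewrite subnn addrA -big_split/= [u _ * _]mulrC; congr (_ + _).
apply: eq_bigr => m _.
by rewrite subSn ?seriesSr ?mulrDr ?[u _ * _]mulrC// ltnW.
Qed.

(** The triangle i + j < N lies in the square [0, N)^2, which lies in the
triangle i + j < 2N.  So the partial sums of the product series and the
products of the partial sums dominate one another, and have the same limit. *)
Lemma cvg_cauchy_product {R : realType} (u v : R^nat) :
  (forall k, 0 <= u k) -> (forall k, 0 <= v k) ->
  cvgn (series u) -> cvgn (series v) ->
  series (fun k => \sum_(m < k.+1) u (k - m)%N * v m) @ \oo -->
    limn (series u) * limn (series v).
Proof.
move=> u0 v0 cu cv; set c := (fun k => _).
have ndu : {homo series u : p q / (p <= q)%N >-> p <= q}.
  by apply: nondecreasing_series => k _ _; exact: u0.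
have ndv : {homo series v : p q / (p <= q)%N >-> p <= q}.
  by apply: nondecreasing_series => k _ _; exact: v0.
have ndc : {homo series c : p q / (p <= q)%N >-> p <= q}.
  by apply: nondecreasing_series => k _ _; apply: sumr_ge0 => m _; exact: mulr_ge0.
have su0 N : 0 <= series u N by apply: sumr_ge0.
have le_prod N : series c N <= series u N * series v N.
  rewrite cauchy_product_series mulrC /series/= big_mkord mulr_suml.
  apply: ler_sum => m _; apply: ler_wpM2l => //; apply: ndu; exact: leq_subr.
have ge_prod N : series u N * series v N <= series c (N + N)%N.
  rewrite cauchy_product_series big_split_ord/=.
  apply: (@le_trans _ _ (\sum_(m < N) v m * series u (N + N - m)%N)).
    rewrite mulrC {1}/series/= big_mkord mulr_suml.
    apply: ler_sum => m _; apply: ler_wpM2l => //; apply: ndu.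
    by rewrite -addnBA ?leq_addr// ltnW.
  by rewrite lerDl; apply: sumr_ge0 => m _; rewrite mulr_ge0.
have cprod : series u N * series v N @[N --> \oo] -->
    limn (series u) * limn (series v) by exact: cvgM.
have cc : cvgn (series c).
  apply: nondecreasing_is_cvgn => //.
  exists (limn (series u) * limn (series v)) => _ [N _ <-].
  apply: (le_trans (le_prod N)); apply: ler_pM => //.
  - by apply: sumr_ge0.
  - exact: nondecreasing_cvgn_le.
  - exact: nondecreasing_cvgn_le.
suff <- : limn (series c) = limn (series u) * limn (series v) by [].
apply/eqP; rewrite eq_le; apply/andP; split.
  by apply: (ler_cvg_to cc cprod); exact: nearW.
apply: (cvgr_to_le cprod); apply: nearW => N.
by apply: (le_trans (ge_prod N)); exact: nondecreasing_cvgn_le.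
Qed.

(** The discrete counterpart of the estimate for gamma means: weights of total
mass 1 average the bounds on |d k - y|. *)
Lemma weighted_average_approx {R : realType} (w d v : R^nat) (y b K : R) :
  (forall k, 0 <= w k) -> series w @ \oo --> (1 : R) ->
  cvgn (series (fun k => w k * v k)) ->
  (forall k, `|d k - y| <= b * (1 + K * v k)) ->
  cvgn (series (fun k => w k * d k)) /\
  `|limn (series (fun k => w k * d k)) - y| <=
    b * (1 + K * limn (series (fun k => w k * v k))).
Proof.
move=> w0 w1 cwv dy.
pose u k := w k * (d k - y); pose z k := w k * (b * (1 + K * v k)).
have zE : z = b *: w + (b * K) *: (fun k => w k * v k).
  by apply/funext => k; rewrite /z !fctE /GRing.scale/=; ring.
have cw : cvgn (series w) by exact: cvgP w1.
have cz1 : cvgn (series (b *: w)) by exact: is_cvg_seriesZ.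
have cz2 : cvgn (series ((b * K) *: (fun k => w k * v k))) by exact: is_cvg_seriesZ.
have cz : cvgn (series z) by rewrite zE; exact: is_cvg_seriesD.
have limz : limn (series z) = b * (1 + K * limn (series (fun k => w k * v k))).
  rewrite zE lim_seriesD// !lim_seriesZ// (cvg_lim _ w1)//.
  by rewrite /GRing.scale/=; ring.
have uz k : `|u k| <= z k by rewrite normrM ger0_norm// ler_wpM2l.
have cnu : cvgn [normed series u].
  apply: (series_le_cvg _ _ uz cz) => k; first exact: normr_ge0.
  exact: le_trans (normr_ge0 _) (uz k).
have cu : cvgn (series u) := normed_cvg cnu.
have dE : (fun k => w k * d k) = u + y *: w.
  by apply/funext => k; rewrite /u !fctE /GRing.scale/=; ring.
have cyw : cvgn (series (y *: w)) by exact: is_cvg_seriesZ.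
rewrite dE; split; first exact: is_cvg_seriesD.
rewrite lim_seriesD// lim_seriesZ// (cvg_lim _ w1)// /GRing.scale/= mulr1 addrK.
by rewrite -limz; apply: le_trans (lim_series_norm cnu) (lim_series_le cnu cz uz).
Qed.

(** * The Dunkl exponential *)

Lemma gamma_mu0 {R : realType} (mu : R) : 0 <= mu -> gamma_mu mu 0 = 1.
Proof.
move=> mu0; rewrite /gamma_mu/= expr0 !mul1r add0r divff// gt_eqF// Gamma_gt0//.
by rewrite ltr_wpDl.
Qed.

Lemma gamma_muS {R : realType} (mu : R) (k : nat) : 0 <= mu ->
  gamma_mu mu k.+1 = (k.+1%:R + 2 * mu * theta k.+1) * gamma_mu mu k.
Proof.
move=> mu0; rewrite /gamma_mu /theta /= uphalf_half.
have G0 : Gamma (mu + 1 / 2) != 0 by rewrite gt_eqF// Gamma_gt0// ltr_wpDl.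
have kE : k%:R = (odd k)%:R + 2 * (k./2)%:R :> R.
  by rewrite -[in LHS](odd_double_half k) natrD -mul2n natrM.
rewrite -[k.+1%:R]natr1 kE; case: (odd k) => /=; rewrite ?add1n ?add0n.
  rewrite factS natrM exprS -[k./2.+1%:R]natr1.
  have -> : (k./2)%:R + 1 + mu + 1 / 2 = (k./2)%:R + mu + 3 / 2 :> R by field.
  move: (Gamma (mu + 1 / 2)) G0 => G G0; move: (Gamma _) => H; by field.
have -> : (k./2)%:R + mu + 3 / 2 = (k./2)%:R + mu + 1 / 2 + 1 :> R by field.
rewrite GammaS; last by rewrite ltr_wpDl// addr_ge0.
rewrite exprS; move: (Gamma (mu + 1 / 2)) G0 => G G0; move: (Gamma _) => H.
by field.
Qed.

(** Compares the Dunkl exponential series with the exponential series. *)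
Lemma fact_le_gamma_mu {R : realType} (mu : R) (k : nat) : 0 <= mu ->
  (k`!)%:R <= gamma_mu mu k.
Proof.
move=> mu0; elim: k => [|k IHk]; first by rewrite gamma_mu0.
rewrite gamma_muS// factS natrM ler_pM//.
by rewrite lerDl mulr_ge0// mulr_ge0.
Qed.

Lemma gamma_mu_gt0 {R : realType} (mu : R) (k : nat) : 0 <= mu ->
  0 < gamma_mu mu k.
Proof.
by move=> mu0; apply: lt_le_trans (fact_le_gamma_mu k mu0); rewrite ltr0n fact_gt0.
Qed.

Lemma is_cvg_dunkl_exp {R : realType} (mu y : R) : 0 <= mu -> 0 <= y ->
  cvgn (pseries (fun k => (gamma_mu mu k)^-1) y).
Proof.
move=> mu0 y0; have := is_cvg_series_exp_coeff y; apply: series_le_cvg => k.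
- by rewrite mulr_ge0 ?exprn_ge0// invr_ge0 ltW// gamma_mu_gt0.
- by rewrite divr_ge0 ?exprn_ge0.
rewrite /exp_coeff/= mulrC ler_wpM2l ?exprn_ge0//.
rewrite lef_pV2 ?posrE ?gamma_mu_gt0 ?ltr0n ?fact_gt0//.
exact: fact_le_gamma_mu.
Qed.

Lemma dunkl_exp_ge1 {R : realType} (mu y : R) : 0 <= mu -> 0 <= y ->
  1 <= dunkl_exp mu y.
Proof.
move=> mu0 y0; have cy := is_cvg_dunkl_exp mu0 y0.
have nd : nondecreasing_seq (pseries (fun k => (gamma_mu mu k)^-1) y).
  apply: nondecreasing_series => k _ _.
  by rewrite mulr_ge0 ?exprn_ge0// invr_ge0 ltW// gamma_mu_gt0.
apply: le_trans (nondecreasing_cvgn_le nd cy 1).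
by rewrite /pseries/series/= big_nat1 gamma_mu0// expr0 invr1 mulr1.
Qed.

(** * The modulus of continuity *)

Lemma in_CtildeP {R : realType} (f : R -> R) : in_Ctilde f ->
  forall e : R, 0 < e -> exists2 d : R, 0 < d &
    forall x y, 0 <= x -> 0 <= y -> `|x - y| < d -> `|f x - f y| < e.
Proof.
move=> fC e e0.
have /fC [E] : entourage [set xy : R * R | `|xy.1 - xy.2| < e].
  by rewrite -entourage_ballE; exists e => //; case=> u v.
rewrite -entourage_ballE => -[d /= d0 dE] Esub; exists d => // x y x0 y0 xy.
apply: (Esub (x, y)); right; rewrite /= !in_itv/= !andbT; split=> //; split=> //.
exact: (dE (x, y)).
Qed.

Lemma in_Ctilde_measurable {R : realType} (f : R -> R) : in_Ctilde f ->
  measurable_fun (`[0, +oo[%classic : set R) f.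
Proof.
move=> fC; apply: subspace_continuous_measurable_fun => //.
apply/subspace_continuousP => x /=; rewrite in_itv/= andbT => x0.
apply/cvgrPdist_lt => e e0; have [d d0 fd] := in_CtildeP fC e0.
near=> t; apply: fd => //.
  have : `[0, +oo[%classic t by near: t; exact: withinT.
  by rewrite /= in_itv/= andbT.
by near: t; apply: cvg_within; exact: nbhsx_ballx.
Unshelve. all: by end_near. Qed.

(** Division of the segment from u to v into N equal parts, which stay in
[0, +oo) by convexity. *)
Lemma oscillation_chain {R : realType} (f : R -> R) (h M : R) :
  (forall u v, 0 <= u -> 0 <= v -> `|u - v| <= h -> `|f u - f v| <= M) ->
  forall (N : nat) u v, 0 <= u -> 0 <= v -> `|u - v| <= N%:R * h ->
    `|f u - f v| <= N%:R * M.
Proof.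
move=> fh; elim=> [u v _ _|N IHN u v u0 v0 uv].
  by rewrite mul0r normr_le0 subr_eq0 => /eqP ->; rewrite subrr normr0 mul0r.
have N1 : 0 < N.+1%:R :> R by rewrite ltr0n.
have N1N : N.+1%:R = N%:R + 1 :> R by rewrite natr1.
have uv' : `|u - v| / N.+1%:R <= h by rewrite ler_pdivrMr// mulrC.
(* Last division point: at distance |u - v| / (N + 1) from v. *)
pose z := (u + N%:R * v) / N.+1%:R.
have z0 : 0 <= z by rewrite divr_ge0 ?ler0n// addr_ge0// mulr_ge0.
have zE : z - v = (u - v) / N.+1%:R by rewrite /z N1N; field; rewrite -N1N gt_eqF.
have uzE : u - z = N%:R * ((u - v) / N.+1%:R).
  by rewrite /z N1N; field; rewrite -N1N gt_eqF.
have -> : f u - f v = (f u - f z) + (f z - f v) by rewrite addrA subrK.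
rewrite -natr1 mulrDl mul1r (le_trans (ler_normD _ _))// lerD//.
  apply: IHN => //; rewrite uzE normrM normr_nat ler_wpM2l ?ler0n//.
  by rewrite normrM normfV normr_nat.
by apply: fh => //; rewrite zE normrM normfV normr_nat.
Qed.

(** Holds because uniform continuity makes the set of oscillations at distance d
bounded: a chain of about 2 d / h steps, where h is the step at which f varies
by less than 1.  Otherwise the supremum would be a default value. *)
Lemma omega_ge {R : realType} (f : R -> R) (d u v : R) : in_Ctilde f ->
  0 <= u -> 0 <= v -> `|u - v| <= d -> `|f u - f v| <= omega f d.
Proof.
move=> fC u0 v0 uv; have [h h0 fh] := in_CtildeP fC ltr01.
have h2 : 0 < h / 2 by rewrite divr_gt0.
pose N := (Num.truncn (d / (h / 2))).+1.
apply: ub_le_sup; last by exists u, v; split.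
exists (N%:R * 1) => _ [s [t [s0 t0 st ->]]].
apply: (oscillation_chain (h := h / 2)) => //.
  move=> a b a0 b0 ab; apply: ltW; apply: fh => //.
  by rewrite (le_lt_trans ab)// ltr_pdivrMr// ltr_pMr// ltr1n.
by rewrite (le_trans st)// -ler_pdivrMr// ltW// truncnS_gt.
Qed.

(** With r = |u - v| / d, the segment splits into floor r + 1 parts of length at
most d, and floor r <= r^2: for r < 1 the floor is 0, and for r >= 1 one has
floor r <= r <= r^2. *)
Lemma omega_quadratic {R : realType} (f : R -> R) (d u v : R) : in_Ctilde f ->
  0 < d -> 0 <= u -> 0 <= v ->
  `|f u - f v| <= omega f d * (1 + d ^- 2 * (u - v) ^+ 2).
Proof.
move=> fC d0 u0 v0; have wd a b := @omega_ge R f d a b fC.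
have w0 : 0 <= omega f d.
  by rewrite (le_trans (normr_ge0 (f 0 - f 0)))// wd// subrr normr0 ltW.
pose r := `|u - v| / d; have r0 : 0 <= r by rewrite divr_ge0 // ltW.
have -> : d ^- 2 * (u - v) ^+ 2 = r ^+ 2.
  by rewrite /r exprMn -normrX ger0_norm ?sqr_ge0// exprVn mulrC.
apply: (le_trans (oscillation_chain wd (N := (Num.truncn r).+1) u0 v0 _)).
  by rewrite -ler_pdivrMr// ltW// truncnS_gt.
rewrite mulrC ler_wpM2l// -natr1 addrC lerD2l.
have [r1|r1] := ltP r 1; first by rewrite (@truncn_def _ r 0%N) ?r0// sqr_ge0.
by rewrite (@le_trans _ _ r) ?truncn_le// expr2 ler_peMl.
Qed.

(** * The weights of the operator and the growth of its moments *)

(** Shape of the gamma distribution attached to the index k, whose density is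
proportional to t^(k + 2 mu theta_k + lam) e^(-nt). *)
Definition gamma_shape {R : realType} (mu lam : R) (k : nat) : R :=
  k%:R + 2 * mu * theta k + lam + 1.

(** Mass that the operator gives to the index k; y stands for n x. *)
Definition dunkl_weight {R : realType} (mu : R) (a : nat -> R) (y : R) (k : nat) : R :=
  dunkl_appell mu a k y / gamma_mu mu k / (dunkl_exp mu y * appell_A mu a 1).

(** Exhibits the weights as a Cauchy product of the normalised Appell series
and the Dunkl exponential series, both with nonnegative terms. *)
Lemma dunkl_weightE {R : realType} (mu : R) (a : nat -> R) (y : R) (k : nat) :
  0 <= mu -> 0 <= y -> appell_A mu a 1 != 0 ->
  dunkl_weight mu a y k = (dunkl_exp mu y)^-1 *
    \sum_(m < k.+1) (appell_coef mu a (k - m)%N / appell_A mu a 1)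
                    * ((gamma_mu mu m)^-1 * y ^+ m).
Proof.
move=> mu0 y0 A0.
have alg (gk gm gd al A e Y : R) : gk != 0 -> gm != 0 -> gd != 0 -> A != 0 ->
    e != 0 ->
    gk / (gm * gd) * al * Y / gk / (e * A) = e^-1 * ((al / gd) / A * (gm^-1 * Y)).
  by move=> h1 h2 h3 h4 h5; field; rewrite h1 h2 h3 h4 h5.
rewrite /dunkl_weight /dunkl_appell mulr_suml mulr_suml mulr_sumr.
apply: eq_bigr => m _; apply: alg => //; rewrite gt_eqF ?gamma_mu_gt0//.
by rewrite (lt_le_trans ltr01)// dunkl_exp_ge1.
Qed.

Lemma normalized_appell_coef_ge0 {R : realType} (mu : R) (a : nat -> R) (k : nat) :
  0 <= mu -> 0 <= a k / appell_A mu a 1 ->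
  0 <= appell_coef mu a k / appell_A mu a 1.
Proof.
move=> mu0 aA; rewrite /appell_coef mulrAC mulr_ge0// invr_ge0 ltW//.
exact: gamma_mu_gt0.
Qed.

Lemma dunkl_exp_term_ge0 {R : realType} (mu y : R) (k : nat) : 0 <= mu -> 0 <= y ->
  0 <= (gamma_mu mu k)^-1 * y ^+ k.
Proof.
by move=> mu0 y0; rewrite mulr_ge0 ?exprn_ge0// invr_ge0 ltW// gamma_mu_gt0.
Qed.

Lemma dunkl_weight_ge0 {R : realType} (mu : R) (a : nat -> R) (y : R) (k : nat) :
  0 <= mu -> 0 <= y -> appell_A mu a 1 != 0 ->
  (forall r, 0 <= a r / appell_A mu a 1) ->
  0 <= dunkl_weight mu a y k.
Proof.
move=> mu0 y0 A0 aA; rewrite dunkl_weightE// mulr_ge0//.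
  by rewrite invr_ge0 (le_trans ler01)// dunkl_exp_ge1.
apply: sumr_ge0 => m _; apply: mulr_ge0.
  exact: normalized_appell_coef_ge0.
exact: dunkl_exp_term_ge0.
Qed.

(** Generating function A(r) e_mu(y r) / (A(1) e_mu(y)) of the weights. *)
Lemma cvg_dunkl_weight_pseries {R : realType} (mu : R) (a : nat -> R) (y r : R) :
  0 <= mu -> 0 <= y -> appell_A mu a 1 != 0 ->
  (forall k, 0 <= a k / appell_A mu a 1) -> 0 <= r ->
  cvgn (pseries (appell_coef mu a) r) ->
  pseries (dunkl_weight mu a y) r @ \oo -->
    (dunkl_exp mu y)^-1 * (appell_A mu a r / appell_A mu a 1 * dunkl_exp mu (y * r)).
Proof.
move=> mu0 y0 A0 aA r0 cAr.
pose al k := appell_coef mu a k / appell_A mu a 1.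
pose be k := (gamma_mu mu k)^-1 * y ^+ k.
have al_ge0 k : 0 <= al k by exact: normalized_appell_coef_ge0.
have be_ge0 k : 0 <= be k by exact: dunkl_exp_term_ge0.
have uE : (fun k => al k * r ^+ k) =
    (appell_A mu a 1)^-1 *: (fun k => appell_coef mu a k * r ^+ k).
  by apply/funext => k; rewrite /al !fctE /GRing.scale/= mulrAC mulrC.
have vE : (fun k => be k * r ^+ k) = (fun k => (gamma_mu mu k)^-1 * (y * r) ^+ k).
  by apply/funext => k; rewrite /be exprMn mulrA.
have cu : cvgn (series (fun k => al k * r ^+ k)) by rewrite uE; exact: is_cvg_seriesZ.
have yr0 : 0 <= y * r by exact: mulr_ge0.
have cv : cvgn (series (fun k => be k * r ^+ k)).
  by rewrite vE; exact: (is_cvg_dunkl_exp mu0 yr0).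
have cc := cvg_cauchy_product (fun k => mulr_ge0 (al_ge0 k) (exprn_ge0 k r0))
  (fun k => mulr_ge0 (be_ge0 k) (exprn_ge0 k r0)) cu cv.
have -> : pseries (dunkl_weight mu a y) r = (dunkl_exp mu y)^-1 *: series (fun k =>
    \sum_(m < k.+1) al (k - m)%N * r ^+ (k - m)%N * (be m * r ^+ m)).
  rewrite -seriesZ; congr series; apply/funext => k.
  rewrite /= dunkl_weightE// !fctE /GRing.scale/= -mulrA mulr_suml; congr (_ * _).
  apply: eq_bigr => m _; rewrite -/(al _) -/(be m) [RHS]mulrACA -exprD subnK//.
  by rewrite -ltnS.
have -> : appell_A mu a r / appell_A mu a 1 = limn (series (fun k => al k * r ^+ k)).
  by rewrite uE lim_seriesZ// mulrC.
have -> : dunkl_exp mu (y * r) = limn (series (fun k => be k * r ^+ k)) by rewrite vE.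
exact: cvgZr.
Qed.

Lemma cvg_dunkl_weight {R : realType} (mu : R) (a : nat -> R) (y : R) :
  0 <= mu -> 0 <= y -> appell_A mu a 1 != 0 ->
  (forall k, 0 <= a k / appell_A mu a 1) ->
  cvgn (pseries (appell_coef mu a) 1) ->
  series (dunkl_weight mu a y) @ \oo --> (1 : R).
Proof.
move=> mu0 y0 A0 aA cA1; have := cvg_dunkl_weight_pseries mu0 y0 A0 aA ler01 cA1.
have -> : pseries (dunkl_weight mu a y) 1 = series (dunkl_weight mu a y).
  by congr series; apply/funext => k; rewrite /= expr1n mulr1.
rewrite divff// mul1r mulr1 mulVf// gt_eqF//.
by rewrite (lt_le_trans ltr01)// dunkl_exp_ge1.
Qed.

Lemma is_cvg_dunkl_weightM {R : realType} (mu : R) (a : nat -> R) (y : R)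
    (v : R^nat) (C r : R) :
  0 <= mu -> 0 <= y -> appell_A mu a 1 != 0 ->
  (forall k, 0 <= a k / appell_A mu a 1) -> 0 <= r ->
  cvgn (pseries (appell_coef mu a) r) ->
  0 <= C -> (forall k, 0 <= v k) -> (forall k, v k <= C * r ^+ k) ->
  cvgn (series (fun k => dunkl_weight mu a y k * v k)).
Proof.
move=> mu0 y0 A0 aA r0 cAr C0 v0 vC.
have cr : cvgn (series (C *: (fun k => dunkl_weight mu a y k * r ^+ k))).
  by apply: is_cvg_seriesZ; exact: cvgP (cvg_dunkl_weight_pseries mu0 y0 A0 aA r0 cAr).
apply: series_le_cvg cr => k.
- by rewrite mulr_ge0 ?dunkl_weight_ge0.
- by rewrite mulr_ge0// mulr_ge0 ?dunkl_weight_ge0 ?exprn_ge0.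
rewrite !fctE /GRing.scale/= mulrCA; apply: ler_wpM2l (vC k).
exact: dunkl_weight_ge0.
Qed.

Lemma gamma_shape_gt0 {R : realType} (mu lam : R) (k : nat) : 0 <= mu -> 0 <= lam ->
  0 < gamma_shape mu lam k.
Proof. by move=> mu0 lam0; rewrite ltr_wpDl// !addr_ge0// !mulr_ge0. Qed.

(** The left-hand side is a second moment, quadratic in k up to a constant,
while r^k = e^(k ln r) is at least (k ln r)^2 / 2. *)
Lemma gamma_shape_quadratic_le {R : realType} (mu lam c x r : R) : 0 <= mu -> 0 <= lam ->
  1 <= c -> 1 < r ->
  exists C : R, 0 <= C /\ forall k,
    (gamma_shape mu lam k / c - x) ^+ 2 + gamma_shape mu lam k / c ^+ 2 <= C * r ^+ k.
Proof.
move=> mu0 lam0 c1 r1; have r0 : 0 < r by rewrite (lt_trans ltr01).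
have l0 : 0 < ln r by rewrite ln_gt0.
pose L := 2 * mu + lam + 1.
have L0 : 0 <= L by rewrite !addr_ge0// mulr_ge0.
(* From (s/c - x)^2 + s/c^2 <= 3 s^2 + 2 x^2, s^2 <= 2 k^2 + 2 L^2 and
   k^2 <= (2 / (ln r)^2) r^k, where s is the shape. *)
exists (12 / ln r ^+ 2 + 6 * L ^+ 2 + 2 * x ^+ 2); split.
  by apply: addr_ge0; [apply: addr_ge0|]; rewrite ?divr_ge0 ?(mulr_ge0 _ (sqr_ge0 _)) ?sqr_ge0.
move=> k.
have c0 : 0 < c by exact: lt_le_trans c1.
have s1 : 1 <= gamma_shape mu lam k by rewrite lerDr !addr_ge0// !mulr_ge0.
have sk : gamma_shape mu lam k <= k%:R + L.
  rewrite /gamma_shape /L -!addrA lerD2l lerD2r; rewrite -[leRHS]mulr1.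
  by rewrite ler_wpM2l ?mulr_ge0// /theta lern1 leq_b1.
set s := gamma_shape mu lam k in s1 sk *.
have rk1 : 1 <= r ^+ k by rewrite exprn_ege1// ltW.
have rk2 : (k%:R * ln r) ^+ 2 <= 2 * r ^+ k.
  rewrite -[r in r ^+ k]lnK ?posrE// -expRM_natl.
  have kl0 : 0 <= k%:R * ln r by rewrite mulr_ge0// ltW.
  have := expR_ge1Dxn 1 kl0; rewrite (_ : 2`! = 2)//; lra.
have kr : k%:R ^+ 2 <= 2 / ln r ^+ 2 * r ^+ k.
  by rewrite mulrAC ler_pdivlMr ?exprn_gt0// -exprMn.
have sc : s / c <= s by rewrite ler_pdivrMr// ler_peMr// (le_trans ler01).
have sc0 : 0 <= s / c by rewrite divr_ge0 ?ltW// (lt_le_trans ltr01).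
have scc : s / c ^+ 2 <= s.
  rewrite ler_pdivrMr ?exprn_gt0// ler_peMr// ?exprn_ege1//.
  by rewrite (le_trans ler01).
have h1 : (s / c - x) ^+ 2 + s / c ^+ 2 <= 3 * s ^+ 2 + 2 * x ^+ 2.
  have : (s / c) ^+ 2 <= s ^+ 2 by rewrite lerXn2r ?nnegrE// (le_trans ler01).
  have : 0 <= (s / c + x) ^+ 2 by exact: sqr_ge0.
  move: (s / c) (s / c ^+ 2) scc => p q; nra.
have h2 : s ^+ 2 <= 2 * k%:R ^+ 2 + 2 * L ^+ 2.
  have : s ^+ 2 <= (k%:R + L) ^+ 2.
    have kL0 : 0 <= k%:R + L by rewrite addr_ge0.
    by rewrite lerXn2r// nnegrE// (le_trans ler01).
  have : 0 <= (k%:R - L) ^+ 2 by exact: sqr_ge0.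
  nra.
apply: (le_trans h1).
have h3 : L ^+ 2 <= L ^+ 2 * r ^+ k by rewrite ler_peMr ?sqr_ge0.
have h4 : x ^+ 2 <= x ^+ 2 * r ^+ k by rewrite ler_peMr ?sqr_ge0.
have -> : (12 / ln r ^+ 2 + 6 * L ^+ 2 + 2 * x ^+ 2) * r ^+ k =
  6 * (2 / ln r ^+ 2 * r ^+ k) + 6 * (L ^+ 2 * r ^+ k) + 2 * (x ^+ 2 * r ^+ k) by ring.
by lra.
Qed.

(** * The rate of approximation *)

(** The constant factor e_mu(n x) A(1) may be moved into the sum only when the
series converges, as the limit operator is total. *)
Lemma DstarE {R : realType} (mu lam : R) (a : nat -> R) (n : nat) (f : R -> R) (x : R) :
  dunkl_exp mu (n%:R * x) != 0 -> appell_A mu a 1 != 0 ->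
  cvgn (series (fun k => dunkl_weight mu a (n%:R * x) k *
    gamma_mean n%:R (gamma_shape mu lam k) f)) ->
  Dstar mu lam a n f x = limn (series (fun k =>
    dunkl_weight mu a (n%:R * x) k * gamma_mean n%:R (gamma_shape mu lam k) f)).
Proof.
move=> e0 A0; set u := (fun k => _ * _) => cu.
have eA0 : dunkl_exp mu (n%:R * x) * appell_A mu a 1 != 0 by rewrite mulf_neq0.
suff -> : Dstar mu lam a n f x = (dunkl_exp mu (n%:R * x) * appell_A mu a 1)^-1 *
    limn (series ((dunkl_exp mu (n%:R * x) * appell_A mu a 1) *: u)).
  by rewrite lim_seriesZ// /GRing.scale/= mulKf.
rewrite /Dstar; set T := (fun k : nat => _).
suff -> : T = (dunkl_exp mu (n%:R * x) * appell_A mu a 1) *: u by [].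
apply/funext => k; rewrite /= /T /u /dunkl_weight !fctE /GRing.scale/= [RHS]mulrA.
rewrite [X in _ = X * _]mulrC divfK//.
rewrite -mulrA; congr (_ * _); rewrite /gamma_mean /gamma_shape; congr (_ * _).
by apply: eq_Rintegral => t _; rewrite /gamma_kernel addrK (mulrC (expR _)).
Qed.

Theorem theorem2 (R : realType) (mu lam : R) (a : nat -> R) (rho : R)
  (hmu : 0 <= mu) (hlam : 0 <= lam)
  (ha0 : a 0%N != 0)
  (hrho : 1 < rho)
  (hA : forall t : R, `|t| < rho -> cvgn (pseries (appell_coef mu a) t))
  (hA1 : appell_A mu a 1 != 0)
  (ha : forall r : nat, 0 <= a r / appell_A mu a 1)
  (f : R -> R) (hfC : in_Ctilde f) (hfE : in_E f)
  (n : nat) (hn : (0 < n)%N) (x : R) (hx : 0 <= x) :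
  `|Dstar mu lam a n f x - f x| <=
    2 * omega f (Num.sqrt (Omega2 mu lam a n x)).
Proof.
have n0 : 0 < n%:R :> R by rewrite ltr0n.
have y0 : 0 <= n%:R * x by rewrite mulr_ge0.
pose w := dunkl_weight mu a (n%:R * x).
pose s := gamma_shape mu lam.
pose v k := gamma_mean n%:R (s k) (fun t => (t - x) ^+ 2).
have s0 k : 0 < s k by exact: gamma_shape_gt0.
have w0 k : 0 <= w k by exact: dunkl_weight_ge0.
have w1 : series w @ \oo --> (1 : R).
  by apply: cvg_dunkl_weight => //; apply: hA; rewrite normr1.
have vE k : v k = (s k / n%:R - x) ^+ 2 + s k / n%:R ^+ 2 by exact: gamma_mean_sq.
(* The variance s / n^2 is at least 1 / n^2, as the shape s is at least 1. *)
have v_ge k : n%:R ^- 2 <= v k.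
  rewrite vE -[leLHS]add0r lerD ?sqr_ge0// ler_peMl ?invr_ge0 ?exprn_ge0//.
  by rewrite /s /gamma_shape lerDr !addr_ge0// !mulr_ge0.
have n2_gt0 : 0 < n%:R ^- 2 :> R by rewrite invr_gt0 exprn_gt0.
have cwv : cvgn (series (fun k => w k * v k)).
  (* Any r with 1 < r < rho would do. *)
  pose r := (1 + rho) / 2.
  have r1 : 1 < r by rewrite /r; lra.
  have r0 : 0 <= r by rewrite /r; lra.
  have cr : cvgn (pseries (appell_coef mu a) r).
    by apply: hA; rewrite ger0_norm// /r; lra.
  have n1 : 1 <= n%:R :> R by rewrite ler1n.
  have [C [C0 vC]] := gamma_shape_quadratic_le x hmu hlam n1 r1.
  apply: (is_cvg_dunkl_weightM hmu y0 hA1 ha r0 cr C0) => k.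
    by rewrite (le_trans _ (v_ge k))// ltW.
  by rewrite vE; exact: vC.
have e0 : dunkl_exp mu (n%:R * x) != 0.
  by rewrite gt_eqF// (lt_le_trans ltr01)// dunkl_exp_ge1.
have OmegaE : Omega2 mu lam a n x = limn (series (fun k => w k * v k)) by exact: DstarE.
have Omega_gt0 : 0 < Omega2 mu lam a n x.
  apply: (lt_le_trans n2_gt0); rewrite OmegaE.
  have -> : n%:R ^- 2 = limn (series (n%:R ^- 2 *: w)) :> R.
    rewrite lim_seriesZ; last exact: cvgP w1.
    by rewrite (cvg_lim _ w1)// /GRing.scale/= mulr1.
  apply: lim_series_le => //; first by apply: is_cvg_seriesZ; exact: cvgP w1.
  by move=> k; rewrite !fctE /GRing.scale/= mulrC ler_wpM2l.
set d := Num.sqrt _; have d0 : 0 < d by rewrite sqrtr_gt0.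
have fd k : `|gamma_mean n%:R (s k) f - f x| <= omega f d * (1 + d ^- 2 * v k).
  apply: gamma_mean_approx => //; first exact: in_Ctilde_measurable.
  by move=> t t0; exact: omega_quadratic.
have [cwf] := weighted_average_approx w0 w1 cwv fd.
rewrite -OmegaE -DstarE// => /le_trans; apply.
have d2 : d ^+ 2 = Omega2 mu lam a n x by rewrite sqr_sqrtr// ltW.
by rewrite d2 mulVf ?gt_eqF// mulrC.
Qed.
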